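(* There is an absolute constant $K$ such that the following holds. Let $k,n,d$ be positive integers with $k\ge2$ and $n\ge d$. If $\mathcal{F}\subset[k]^n$ does not contain a $d$-dimensional Boolean algebra, then $|\mathcal{F}|\le K\,k^{\,n-1/2^{d-1}}\,n^{-1/2^{d}}$. In particular, $b(n,d)\le K\,2^n n^{-1/2^d}$.
   Context: $[k]^n=\{1,\dots,k\}^n$. Two vectors $\mathbf v,\mathbf w\in\{0,1,\dots,k-1\}^n$ are disjoint if for every $i\in[n]$ at most one of $\mathbf v(i),\mathbf w(i)$ is nonzero. A set $B\subset[k]^n$ is a $d$-dimensional Boolean algebra if there exist $\mathbf v_0\in[k]^n$ and nonzero, pairwise disjoint $\mathbf v_1,\dots,\mathbf v_d\in\{0,\dots,k-1\}^n$ such that $B=\{\mathbf v_0+\sum_{i\in I}\mathbf v_i: I\subset[d]\}$. In $2^{[n]}$, a $d$-dimensional Boolean algebra is a set of the form $\{X_0\cup\bigcup_{i\in I}X_i: I\subset[d]\}$ with $X_0,X_1,\dots,X_d\subset[n]$ pairwise disjoint and $X_1,\dots,X_d$ nonempty (equivalently, a Boolean algebra in $[2]^n$ under the natural identification). $b(n,d)$ is the maximum size of a family in $2^{[n]}$ containing no $d$-dimensional Boolean algebra. *)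

(* Defs.v *)
From mathcomp Require Import all_boot.
From Stdlib Require Import Reals.
Set Implicit Arguments. Unset Strict Implicit. Unset Printing Implicit Defensive.

(* [k]^n is modelled as functions 'I_n -> 'I_k; value j : 'I_k stands for j+1. *)
Definition cube (k n : nat) := {ffun 'I_n -> 'I_k}.

Definition ba_point (k n d : nat) (v0 : cube k n) (v : 'I_d -> 'I_n -> nat)
  (I : {set 'I_d}) (x : 'I_n) : nat :=
  (v0 x : nat) + \sum_(i in I) v i x.

Definition contains_boolean_algebra (k n d : nat) (F : {set cube k n}) : Prop :=
  exists (v0 : cube k n) (v : 'I_d -> 'I_n -> nat),
    (forall i x, v i x < k) /\
    (forall i, exists x, v i x <> 0) /\
    (forall i j x, i <> j -> v i x = 0 \/ v j x = 0) /\
    (forall I : {set 'I_d}, exists w : cube k n, w \in F /\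
        forall x, (w x : nat) = ba_point v0 v I x).

Definition set_ba_point (n d : nat) (X0 : {set 'I_n}) (X : 'I_d -> {set 'I_n})
  (I : {set 'I_d}) : {set 'I_n} := X0 :|: \bigcup_(i in I) X i.

Definition contains_set_boolean_algebra (n d : nat) (F : {set {set 'I_n}}) : Prop :=
  exists (X0 : {set 'I_n}) (X : 'I_d -> {set 'I_n}),
    (forall i, X i != set0) /\
    (forall i, [disjoint X0 & X i]) /\
    (forall i j, i <> j -> [disjoint X i & X j]) /\
    (forall I : {set 'I_d}, set_ba_point X0 X I \in F).

(* b(n,d) is the max size of such a family; "b(n,d) <= B" is stated as:
   every family without a d-dim Boolean algebra has size <= B. *)
Definition b_le (n d : nat) (B : R) : Prop :=
  forall F : {set {set 'I_n}}, ~ contains_set_boolean_algebra d F ->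
    (INR #|F| <= B)%R.

(* Main.v *)
(* Write s = k sqrt n; a family without a (d+1)-dimensional algebra is shown to
   have density at most 16 s^(-1/2^d), by induction on d.

   The cube [k]^n splits into symmetric chains (de Bruijn, Tengbergen and
   Kruyswijk), as many as there are points of middle rank. A point of given rank
   in [k]^n is determined by its projection to [k]^(n-1), whose rank lies in a
   window of length k, so a Littlewood-Offord argument bounds the number of
   chains by 3 k^n / s. A family without a 1-dimensional algebra is an antichain,
   which settles d = 0.

   For d > 0 write [k]^n = A x B with A = [k]^m. If two comparable points a < a'
   of A have fibres of F with intersection G, a d-dimensional algebra in G
   together with a' - a gives a (d+1)-dimensional one in F, so by induction G has
   density at most beta in B. Cauchy-Schwarz along each chain c of A bounds the
   part of F over c by |B| + |c| |B| sqrt beta, and summing over the chains of A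
   bounds the density of F by 3 / (k sqrt m) + sqrt beta. Taking m = n/2 works
   if n >= 2d; otherwise n^(1/2^d) is bounded and m = 1 suffices. *)
Require Import Defs.
From mathcomp Require Import all_boot.
From Stdlib Require Import Reals Lra.
From mathcomp Require Import zify.
(* [Reals] rebinds [_ ^ _] on nat to [Nat.pow]; this restores [expn]. *)
Import ssrnat.
Set Implicit Arguments. Unset Strict Implicit. Unset Printing Implicit Defensive.

(** * Symmetric chain decomposition of [k]^n *)

Section Hooks.
Variables (T U V : Type) (f : T -> U -> V).

(* Nested L-shaped pieces of the grid [c] x [bs], each running along the least
   element of [bs] and then up over the last element of [c]. *)
Fixpoint hooks (bs : seq U) (c : seq T) : seq (seq V) :=
  match bs, c with
  | b :: bs', a :: c' =>
      ([seq f x b | x <- a :: c'] ++ [seq f (last a c') b' | b' <- bs'])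
        :: hooks bs' (belast a c')
  | _, _ => [::]
  end.
End Hooks.

(** The first hook uses up the row of the first element of [bs] and the column of the last element
    of [c]; what is left is again a grid, filled by the other hooks. *)
Lemma perm_hooks (T U : Type) (V : eqType) (f : T -> U -> V) bs c :
  perm_eq (flatten (hooks f bs c)) [seq f x b | b <- bs, x <- c].
Proof.
apply/permP => P.
elim: bs c => [|b bs IH] [|a c] //; first by elim: bs {IH}.
rewrite -/(hooks _ _ _) allpairs_cons /= -/(hooks _ _ _) !count_cat IH.
have E : forall bs, count P [seq f x b | b <- bs, x <- a :: c] =
   count P [seq f (last a c) b' | b' <- bs] + count P [seq f x b | b <- bs, x <- belast a c].
  elim=> // b' bs' IH'.
  rewrite !allpairs_cons !count_cat IH' lastI map_rcons -cats1 count_cat /=; lia.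
rewrite E /=; lia.
Qed.

Section CubeOrder.
Variable k : nat.

Definition cube_le n (x y : cube k n) := [forall i, x i <= y i].

Definition rk n (x : cube k n) := \sum_i (x i : nat).

Definition cube_cons n (x : cube k n) (b : 'I_k) : cube k n.+1 :=
  [ffun i => oapp x b (unlift ord0 i)].

Definition cube_tail n (x : cube k n.+1) : cube k n := [ffun i => x (lift ord0 i)].

Lemma cube_consK n (x : cube k n.+1) : cube_cons (cube_tail x) (x ord0) = x.
Proof.
by apply/ffunP => i; rewrite ffunE; case: unliftP => [j ->|->] //=; rewrite ffunE.
Qed.

Lemma cube_cons0 n (x : cube k n) b : cube_cons x b ord0 = b.
Proof. by rewrite ffunE unlift_none. Qed.

Lemma cube_tailK n (x : cube k n) b : cube_tail (cube_cons x b) = x.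
Proof. by apply/ffunP => i; rewrite !ffunE liftK. Qed.

Lemma rk_cons n (x : cube k n) b : rk (cube_cons x b) = rk x + b.
Proof.
rewrite /rk big_ord_recl addnC; congr (_ + _); last by rewrite cube_cons0.
by apply: eq_bigr => i _; rewrite ffunE liftK.
Qed.

Lemma cube_le_refl n (x : cube k n) : cube_le x x.
Proof. exact/forallP. Qed.

Lemma cube_le_cons n (x y : cube k n) (b c : 'I_k) :
  cube_le x y -> b <= c -> cube_le (cube_cons x b) (cube_cons y c).
Proof.
move=> /forallP xy bc; apply/forallP => i; rewrite !ffunE.
by case: unliftP => [j _|_] //=.
Qed.

(* A saturated chain whose least and greatest ranks add up to [N]. *)
Definition sym_chain n N (c : seq (cube k n)) :=
  pairwise (@cube_le n) c /\
  exists2 r, r.*2 <= N & map (@rk n) c = iota r (N - r.*2).+1.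

(** The numerical hypothesis says that the first hook, which runs from rank [r + s] to rank
    [(r + p - 1) + (s + q - 1)], is symmetric for [N]. Each further hook raises [s] by one and
    lowers [p] and [q] by one, which keeps the equation. *)
Lemma sym_hooks n (bs : seq 'I_k) (c : seq (cube k n)) s q r p N :
  pairwise (@cube_le n) c -> map (@rk n) c = iota r p ->
  map val bs = iota s q -> (r + s).*2 + p + q = N.+2 ->
  forall h, h \in hooks (@cube_cons n) bs c -> sym_chain N h.
Proof.
elim: bs c s q p => [|b bs IH] [|a c] s q p //= /andP[ac pc].
case: q => [|q] //; case: p => [|p] //= [ra rc] [rb rbs] EN h.
rewrite inE.
have [lastc pbc] : all (@cube_le n ^~ (last a c)) (belast a c) /\
    pairwise (@cube_le n) (belast a c).
  by apply/andP; rewrite -pairwise_rcons -lastI /= ac pc.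
move=> /predU1P[->{h}|]; last first.
  apply: (IH _ s.+1 q p) => //.
  - have : map (@rk n) (a :: c) = iota r p.+1 by rewrite /= ra rc.
    rewrite lastI map_rcons -addn1 iotaD /= cats1.
    by move/rcons_inj => [].
  - by rewrite -EN; lia.
have rl : rk (last a c) = r + p.
  rewrite -last_map ra rc; elim: (p) (r) => [|p' IHp] r' /=; first by rewrite addn0.
  by rewrite IHp addSnnS.
split.
  rewrite -cat_cons pairwise_cat; apply/and3P; split.
  - apply/allrelP => u v; rewrite -[cube_cons a b :: _]/(map (fun x => cube_cons x b) (a :: c)).
    move=> /mapP[x xc ->] /mapP[b' b'bs ->].
    apply: cube_le_cons.
      move: xc; rewrite lastI mem_rcons inE => /predU1P[->|/(allP lastc) //].
      exact: cube_le_refl.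
    have : val b' \in iota s.+1 q by rewrite -rbs map_f.
    by rewrite mem_iota /= -rb => /andP[/ltnW].
  - rewrite -[cube_cons a b :: _]/(map (fun x => cube_cons x b) (a :: c)) pairwise_map.
    move: (conj ac pc) => /andP.
    rewrite -[_ && _]/(pairwise _ (a :: c)).
    apply: sub_pairwise => x y xy; exact: cube_le_cons.
  - rewrite pairwise_map.
    have: pairwise ltn (map val bs) by
      rewrite rbs -sorted_pairwise ?iota_ltn_sorted //; exact: ltn_trans.
    rewrite pairwise_map; apply: sub_pairwise => x y /= /ltnW xy.
    by apply: cube_le_cons; rewrite ?cube_le_refl.
exists (r + s); first lia.
rewrite -cat_cons -[cube_cons a b :: _]/(map (fun x => cube_cons x b) (a :: c)) map_cat -!map_comp.
have -> : (N - (r + s).*2).+1 = p.+1 + q by lia.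
rewrite iotaD; congr (_ ++ _).
  rewrite (eq_map (g := addn s \o @rk n)); last by move=> x /=; rewrite rk_cons addnC rb.
  by rewrite map_comp /= ra rc -[_ :: _]/(map _ (iota r p.+1)) -iotaDl addnC.
rewrite (eq_map (g := addn (r + p) \o val)); last by move=> x /=; rewrite rk_cons rl.
by rewrite map_comp rbs -iotaDl; congr iota; lia.
Qed.

(** The product of a symmetric chain with the chain ['I_k] is cut into hooks, so a decomposition in
    dimension [n] lifts to dimension [n.+1]; the greatest rank [n * k.-1] grows by [k.-1]. *)
Lemma sym_chain_partition n : 0 < k ->
  exists2 Cs : seq (seq (cube k n)), perm_eq (flatten Cs) (enum (cube k n)) &
    forall c, c \in Cs -> sym_chain (n * k.-1) c.
Proof.
move=> k0; elim: n => [|n [Cs pCs symCs]].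
  exists [:: enum (cube k 0)]; first by rewrite /= cats0.
  have E : size (enum (cube k 0)) = 1 by rewrite -cardE card_ffun !card_ord.
  case: (enum _) E => [|x [|]] // _ c; rewrite inE => /eqP ->.
  split=> //; exists 0 => //=; by rewrite /rk big_ord0.
exists (flatten [seq hooks (@cube_cons n) (enum 'I_k) c | c <- Cs]); last first.
  move=> h /flattenP[hs /mapP[c cCs ->]].
  have [pc [r rN rc]] := symCs _ cCs.
  apply: (sym_hooks pc rc (val_enum_ord k)); lia.
have inj : injective (fun p : cube k n * 'I_k => cube_cons p.1 p.2).
  move=> [x b] [y c] /= E.
  move: (congr1 (@cube_tail n) E) (congr1 (fun z : cube k n.+1 => z ord0) E).
  by rewrite !cube_tailK !cube_cons0 => -> ->.
(* [P] lists the cube as pairs of first coordinate and tail; the hooks of all chains together are a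
   rearrangement of it. *)
set P := [seq cube_cons x b | b <- enum 'I_k, x <- flatten Cs].
apply: (@perm_trans _ P).
  rewrite /P; elim: (Cs) => [|c Cs' IH] /=.
    by elim: (enum _).
  rewrite flatten_cat; apply: perm_trans (perm_cat (perm_hooks _ _ _) IH) _.
  apply/permP => Q; rewrite count_cat.
  elim: (enum _) => // b bs IHb; rewrite !allpairs_cons !map_cat !count_cat -?IHb; exact: addnACA.
have uP : uniq P.
  apply: allpairs_uniq; [exact: enum_uniq|by rewrite (perm_uniq pCs) enum_uniq|].
  by move=> [b x] [c y] _ _ /= E; have [-> ->] := inj (x, b) (y, c) E.
apply: uniq_perm => //; first exact: enum_uniq.
move=> x; rewrite mem_enum; apply/allpairsP; exists (x ord0, cube_tail x).
by rewrite mem_enum (perm_mem pCs) mem_enum /= cube_consK.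
Qed.

End CubeOrder.

(** * Number of chains and size of antichains *)

Definition middle_card k n := #|[set x : cube k n | rk x == (n * k.-1)./2]|.

Lemma card_flatten (T : finType) (Cs : seq (seq T)) (A : {set T}) :
  perm_eq (flatten Cs) (enum T) -> #|A| = \sum_(c <- Cs) count (mem A) c.
Proof.
move=> pCs; rewrite cardE size_filter -enumT -(permP pCs).
by rewrite count_flatten sumnE big_map.
Qed.

(** The ranks along a symmetric chain fill the interval from [r] to [N - r], where [N = n * k.-1],
    so each chain has exactly one point of middle rank. *)
Lemma chain_partition k n : 0 < k ->
  exists2 Cs : seq (seq (cube k n)), perm_eq (flatten Cs) (enum (cube k n)) &
    size Cs = middle_card k n /\ {in Cs, forall c, pairwise (@cube_le k n) c}.
Proof.
move=> k0; have [Cs pCs symCs] := sym_chain_partition n k0.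
exists Cs => //; split; last by move=> c /symCs [].
rewrite /middle_card (card_flatten _ pCs) -sum1_size.
rewrite big_seq [RHS]big_seq; apply: eq_bigr => c /symCs[_ [r rN rc]].
rewrite (eq_count (a2 := preim (@rk k n) (pred1 (n * k.-1)./2))); last by move=> x; rewrite !inE.
rewrite -count_map rc count_uniq_mem ?iota_uniq // mem_iota; lia.
Qed.

(** A chain meets an antichain at most once, so there are no more points than chains. *)
Lemma antichain_card k n (E : {set cube k n}) : 0 < k ->
  {in E &, forall x y, cube_le x y -> x = y} -> #|E| <= middle_card k n.
Proof.
move=> k0 antiE; have [Cs pCs [<- chain]] := chain_partition n k0.
have uCs : uniq (flatten Cs) by rewrite (perm_uniq pCs) enum_uniq.
rewrite (card_flatten _ pCs) -sum1_size.
rewrite big_seq [leqRHS]big_seq; apply: leq_sum => c cCs.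
rewrite -size_filter.
have: all (mem E) [seq x <- c | x \in E] by exact: filter_all.
have: uniq [seq x <- c | x \in E].
  by apply: filter_uniq; move: uCs; case/splitPr: cCs => s1 s2;
     rewrite flatten_cat /= !cat_uniq => /and4P[_ _ ? _].
have := pairwise_filter (mem E) (chain _ cCs).
case: [seq x <- c | x \in E] => [|x [|y s]] //=.
move=> /andP[/andP[le _] _] /andP[xy _] /and3P[xE yE _].
by move: xy; rewrite (antiE _ _ xE yE le) inE eqxx.
Qed.

(** * The size of the middle rank *)

Lemma rank_card2 n r : #|[set x : cube 2 n | rk x == r]| <= 'C(n, r).
Proof.
pose S (x : cube 2 n) := [set i | x i == 1 :> nat].
have injS : injective S.
  move=> x y /setP E; apply/ffunP => i; move: (E i); rewrite !inE.
  by case: (x i) (y i) => [[|[|?]] ?] [[|[|?]] ?] //= _; apply/val_inj.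
rewrite -[X in 'C(X, _)]card_ord -card_draws -(card_imset _ injS).
apply/subset_leq_card/subsetP => A /imsetP[x]; rewrite !inE => /eqP <- ->.
rewrite -sum1dep_card /rk big_mkcond /=; apply/eqP/eq_bigr => i _.
by case: (x i) => [[|[|?]] ?].
Qed.

(** For [n = 2 * m] by induction on [m], where the step reduces to [(2 * m + 1) * (2 * m + 3) <= (2
    * m + 2) ^ 2]. The identity [H] then carries the even case to the odd one. *)
Lemma central_binomial n : 'C(n, n./2) ^ 2 * n.+1 <= 4 ^ n.
Proof.
have H m : (2 * m + 1) * 'C(2 * m, m) = m.+1 * 'C(2 * m + 1, m).
  have -> : 'C(2 * m + 1, m) = 'C(2 * m + 1, m.+1).
    by rewrite -[RHS]bin_sub; [rewrite (_ : _ - _ = m)|]; lia.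
  by rewrite -mul_bin_diag addn1.
have even m : 'C(2 * m, m) ^ 2 * (2 * m).+1 <= 16 ^ m.
  elim: m => // m IH.
  have E : 'C(2 * m.+1, m.+1) = 2 * 'C(2 * m + 1, m).
    apply/eqP; rewrite -(eqn_pmul2l (ltn0Sn m)) -mul_bin_diag.
    by rewrite (_ : (2 * m.+1).-1 = 2 * m + 1); [apply/eqP|]; lia.
  rewrite E; move: (H m) IH; set D := 'C(_, m); set F := 'C(_, m) => HDF IH.
  rewrite -(leq_pmul2l (_ : 0 < m.+1 ^ 2)) // (expnS 16).
  have -> : m.+1 ^ 2 * ((2 * F) ^ 2 * (2 * m.+1).+1) = 4 * ((m.+1 * F) ^ 2 * (2 * m + 3)).
    by rewrite !expnMn (_ : (2 * m.+1).+1 = 2 * m + 3); [rewrite -!mulnA; nia|lia].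
  rewrite -HDF expnMn.
  have -> : 4 * ((2 * m + 1) ^ 2 * D ^ 2 * (2 * m + 3)) =
      4 * (2 * m + 1) * (2 * m + 3) * (D ^ 2 * (2 * m).+1).
    by rewrite -addn1; move: (D ^ 2) => Z; rewrite !expnS expn0 !muln1; lia.
  apply: (@leq_trans (4 * (2 * m + 1) * (2 * m + 3) * 16 ^ m)); first by rewrite leq_mul2l IH orbT.
  by rewrite mulnA leq_mul2r; apply/orP; right; rewrite expnS expn1; nia.
have [m [En|En]] : exists m, n = 2 * m \/ n = 2 * m + 1.
  by exists n./2; have := odd_double_half n; case: (odd n); lia.
  by rewrite En (_ : (2 * m)./2 = m) ?(expnM 4 2) //; lia.
rewrite En (_ : (2 * m + 1)./2 = m); last lia.
move: (H m) (even m); set D := 'C(_, m); set F := 'C(_, m) => HDF IH.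
rewrite -(leq_pmul2l (_ : 0 < m.+1 ^ 2)) // mulnA -expnMn -HDF expnMn expnD (expnM 4 2).
have -> : (2 * m + 1) ^ 2 * D ^ 2 * (2 * m + 1).+1 =
    (2 * m + 1) * (2 * m + 2) * (D ^ 2 * (2 * m).+1).
  by rewrite -addn1; move: (D ^ 2) => Z; rewrite !expnS expn0 !muln1; lia.
apply: (@leq_trans ((2 * m + 1) * (2 * m + 2) * 16 ^ m)); first by rewrite leq_mul2l IH orbT.
rewrite [(4 ^ 2) ^ m * _]mulnC mulnA leq_mul2r; apply/orP; right; rewrite expnS expn1; nia.
Qed.

Section Windows.
Variables (k : nat) (k2 : 2 <= k).

Lemma half_shift_proof (x : 'I_k) : (x + k./2) %% k < k.
Proof. by rewrite ltn_mod; lia. Qed.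

(** A permutation of ['I_k] that moves every value by at least [k./2], since [k - k./2 >= k./2]. *)
Definition half_shift (x : 'I_k) : 'I_k := Ordinal (half_shift_proof x).

Lemma half_shiftE (x : 'I_k) :
  half_shift x = x + k./2 :> nat \/ half_shift x + (k - k./2) = x :> nat.
Proof.
rewrite /=; have xk := ltn_ord x; have [lt|ge] := ltnP (x + k./2) k.
  by left; rewrite modn_small.
by right; rewrite -(subnK ge) modnDr modn_small; lia.
Qed.

Lemma half_shift_inj : injective half_shift.
Proof.
move=> x y /(congr1 val)/= /eqP; rewrite eqn_modDr !modn_small // => /eqP.
exact: val_inj.
Qed.

(* Littlewood-Offord: for every fixed sign vector [e] the map toggling the
   coordinates selected by [e] preserves the uniform distribution, whereas for
   fixed [x] the sign vectors leading into the window form an antichain, since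
   every toggle moves the rank by at least [k./2]. *)
Lemma rank_window n lo :
  #|[set x : cube k n | lo <= rk x < lo + k./2]| * 2 ^ n <= k ^ n * 'C(n, n./2).
Proof.
set W := [set x | _].
pose toggle (e : {ffun 'I_n -> bool}) (x : cube k n) : cube k n :=
  [ffun i => if e i then half_shift (x i) else x i].
have toggle_inj e : injective (toggle e).
  move=> x y /ffunP E; apply/ffunP => i; move: (E i); rewrite !ffunE.
  by case: (e i) => // /half_shift_inj.
have card_toggle (A : {set cube k n}) e : \sum_x (toggle e x \in A) = #|A|.
  rewrite -(card_preimset _ (@toggle_inj e)) -sum1_card [RHS]big_mkcond.
  by apply: eq_bigr => x _; rewrite inE; case: (_ \in _).
have -> : #|W| * 2 ^ n = \sum_(x : cube k n) \sum_(e : {ffun 'I_n -> bool}) (toggle e x \in W).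
  rewrite exchange_big /= (eq_bigr (fun=> #|W|)) => [|e _]; last exact: card_toggle.
  by rewrite sum_nat_const card_ffun card_bool card_ord mulnC.
have -> : k ^ n * 'C(n, n./2) = \sum_(x : cube k n) 'C(n, n./2).
  by rewrite sum_nat_const card_ffun !card_ord.
apply: leq_sum => x _.
(* [up e] marks the coordinates where [e] selects the larger of [x i] and [half_shift (x i)]. In
   this coding a larger sign vector gives a larger toggled point. *)
pose up (e : {ffun 'I_n -> bool}) : cube 2 n :=
  [ffun i => inord ((x i < half_shift (x i)) == e i)].
have upE e i : up e i = ((x i < half_shift (x i)) == e i) :> nat.
  by rewrite ffunE inordK //; case: eqP.
have up_inj : injective up.
  move=> e f /ffunP E; apply/ffunP => i; have := congr1 val (E i).
  by rewrite /= !upE; case: (e i) (f i) (_ < _) => [] [] [].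
rewrite (_ : \sum_e _ = #|[set e | toggle e x \in W]|); last first.
  rewrite -sum1dep_card [RHS]big_mkcond.
  by apply: eq_bigr => e _; case: (_ \in _).
rewrite -(card_imset _ up_inj).
apply: leq_trans (_ : middle_card 2 n <= _); last first.
  by rewrite /middle_card muln1; exact: rank_card2.
apply: antichain_card => // _ _ /imsetP[e + ->] /imsetP[f + ->].
rewrite !inE => We Wf /forallP le; congr up; apply/eqP/negPn/negP => ef.
have step i : toggle e x i + (if e i == f i then 0 else k./2) <= toggle f x i.
  move: (le i); rewrite !upE !ffunE; have := half_shiftE (x i).
  case: (e i) (f i) => [] [] /=; lia.
have [i efi] : exists i, e i != f i.
  by apply/existsP; apply: contra_neqT ef => /existsPn E; apply/ffunP => i; apply/eqP/negPn/E.
have : rk (toggle e x) + k./2 <= rk (toggle f x).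
  rewrite /rk (bigD1 i) //= [leqRHS](bigD1 i) //= addnAC.
  apply: leq_add; first by have := step i; rewrite (negPf efi).
  by apply: leq_sum => j _; apply: leq_trans (step j); exact: leq_addr.
lia.
Qed.

(** Three windows of length [k./2] cover the [k] possible ranks of the projection because [k >= 2];
    the 9 is the square of their number. *)
Lemma middle_card_le n : middle_card k n.+1 ^ 2 * n.+1 <= 9 * (k ^ n) ^ 2.
Proof.
(* Tails of points of rank [r] have ranks from [lo] to [r]; if [r.+1 < k], the truncated [lo] is 0
   and still a lower bound. *)
set r := (n.+1 * k.-1)./2; set h := k./2; set lo := r.+1 - k.
pose W l := [set x : cube k n | l <= rk x < l + h].
have le3 : middle_card k n.+1 <= #|W lo| + #|W (lo + h)| + #|W (lo + h + h)|.
  apply: leq_trans (_ : #|W lo :|: W (lo + h) :|: W (lo + h + h)| <= _); last first.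
    by rewrite (leq_trans (leq_card_setU _ _)) // leq_add2r leq_card_setU.
  rewrite /middle_card -/r -(card_in_imset (f := @cube_tail k n)).
    apply/subset_leq_card/subsetP => y /imsetP[x]; rewrite !inE.
    rewrite -{1}(cube_consK x) rk_cons => /eqP E ->.
    have := ltn_ord (x ord0); rewrite /lo /h -E.
    have h3 : k <= k./2 + k./2 + k./2 by lia.
    move: (rk _) (val (x ord0)) => a b /=; lia.
  move=> x y; rewrite !inE -{1}(cube_consK x) -{1}(cube_consK y) !rk_cons.
  move=> /eqP Ex /eqP Ey E; rewrite -(cube_consK x) -(cube_consK y) E.
  by congr cube_cons; apply: val_inj => /=; move: Ex; rewrite -Ey E; lia.
have := central_binomial n; have := rank_window n lo.
have := rank_window n (lo + h); have := rank_window n (lo + h + h).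
rewrite -/h -!/(W _); set C := 'C(_, _) => H1 H2 H3 HC.
have le : middle_card k n.+1 * 2 ^ n <= 3 * (k ^ n * C).
  by apply: leq_trans (leq_mul le3 (leqnn _)) _; rewrite !mulnDl; lia.
have p0 : 0 < 4 ^ n by rewrite expn_gt0.
have E4 : 4 ^ n = (2 ^ n) ^ 2 by rewrite -expnM mulnC expnM.
rewrite -(leq_pmul2r p0) mulnAC {1}E4 -expnMn.
apply: leq_trans (_ : (3 * (k ^ n * C)) ^ 2 * n.+1 <= _); first by rewrite leq_mul2r leq_sqr le.
by rewrite !expnMn mulnA -mulnA leq_mul2l HC orbT.
Qed.
End Windows.

(** * Cauchy-Schwarz for sets with small intersections *)

Lemma sqr_sum_le (B : finType) (f : B -> nat) :
  (\sum_b f b) ^ 2 <= #|B| * \sum_b f b ^ 2.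
Proof.
rewrite -(leq_pmul2l (_ : 0 < 2)) //.
have -> : 2 * (\sum_b f b) ^ 2 = \sum_b \sum_c 2 * (f b * f c).
  rewrite -mulnn big_distrlr /= big_distrr; apply: eq_bigr => b _.
  by rewrite big_distrr.
have -> : 2 * (#|B| * \sum_b f b ^ 2) = \sum_b \sum_c (f b ^ 2 + f c ^ 2).
  rewrite [RHS](eq_bigr (fun b => #|B| * f b ^ 2 + \sum_c f c ^ 2)) => [|b _].
    by rewrite big_split /= -big_distrr sum_nat_const mul2n addnn.
  by rewrite big_split sum_nat_const.
by apply: leq_sum => b _; apply: leq_sum => c _; rewrite nat_Cauchy.
Qed.

(** Let [f b] count the members of [S] containing [b]. Its second moment is the sum of [#|X :&: Y|]
    over ordered pairs; the diagonal gives the linear term, the other pairs the term with [N]. *)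
Lemma sqr_sum_card_le (B : finType) (N : nat) (S : seq {set B}) :
  pairwise (fun X Y : {set B} => #|X :&: Y| <= N) S ->
  (\sum_(X <- S) #|X|) ^ 2 <= #|B| * (\sum_(X <- S) #|X| + size S ^ 2 * N).
Proof.
move=> pS; pose f b := \sum_(X <- S) (b \in X : nat).
have cardE (X : {set B}) : #|X| = \sum_b (b \in X).
  by rewrite -sum1_card big_mkcond; apply: eq_bigr => b _; case: (b \in X).
have -> : (\sum_(X <- S) #|X|) ^ 2 = (\sum_b f b) ^ 2.
  by congr (_ ^ 2); rewrite exchange_big; apply: eq_bigr => X _.
apply: leq_trans (sqr_sum_le f) _; rewrite leq_mul2l; apply/orP; right.
have -> : \sum_b f b ^ 2 = \sum_(X <- S) \sum_(Y <- S) #|X :&: Y|.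
  rewrite (eq_bigr (fun b => \sum_(X <- S) \sum_(Y <- S) (b \in X :&: Y : nat))) => [|b _].
    rewrite exchange_big; apply: eq_bigr => X _; rewrite exchange_big.
    by apply: eq_bigr => Y _.
  rewrite /f -mulnn big_distrlr; apply: eq_bigr => X _; apply: eq_bigr => Y _.
  by rewrite in_setI /= mulnb.
elim: S pS {f} => [|X S IH] /=; first by rewrite !big_nil.
move=> /andP[XS /IH {}IH].
have le : \sum_(Y <- S) #|X :&: Y| <= size S * N.
  elim: S XS {IH} => [|Y S IH] /=; rewrite ?big_nil // big_cons mulSn.
  by move=> /andP[XY /IH]; exact: leq_add.
rewrite 2!big_cons setIid.
have -> : \sum_(Y <- S) \sum_(Z <- X :: S) #|Y :&: Z| =
    \sum_(Y <- S) #|X :&: Y| + \sum_(Y <- S) \sum_(Z <- S) #|Y :&: Z|.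
  by rewrite -big_split; apply: eq_bigr => Y _; rewrite big_cons setIC.
rewrite big_cons.
move: IH le; move: (\sum_(_ <- _) _) (\sum_(_ <- _) _) (\sum_(_ <- _) _) => a b c IH le.
nia.
Qed.

Lemma INR_muln m n : INR (m * n)%N = (INR m * INR n)%R. Proof. exact: mult_INR. Qed.
Lemma INR_addn m n : INR (m + n)%N = (INR m + INR n)%R. Proof. exact: plus_INR. Qed.
Lemma INR_expn m n : INR (m ^ n)%N = (INR m ^ n)%R.
Proof. by elim: n => // n IH; rewrite expnS INR_muln IH. Qed.
Lemma INR_leq m n : m <= n -> (INR m <= INR n)%R. Proof. by move/leP; exact: le_INR. Qed.

(** * Slices of a family over a product of cubes *)

Section Product.
Variables k m p : nat.

Definition cube_cat (a : cube k m) (b : cube k p) : cube k (m + p) :=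
  [ffun i => match fintype.split i with inl j => a j | inr j => b j end].

Lemma cube_catl a b i : cube_cat a b (lshift p i) = a i.
Proof. by rewrite ffunE (unsplitK (inl i)). Qed.

Lemma cube_catr a b i : cube_cat a b (rshift m i) = b i.
Proof. by rewrite ffunE (unsplitK (inr i)). Qed.

Lemma cube_cat_bij : bijective (fun ab => cube_cat ab.1 ab.2).
Proof.
exists (fun x : cube k (m + p) => ([ffun i => x (lshift p i)] : cube k m,
                                   [ffun i => x (rshift m i)] : cube k p)) => [[a b]|x] /=.
  by congr (_, _); apply/ffunP => i; rewrite ffunE (cube_catl, cube_catr).
by apply/ffunP => i; rewrite !ffunE; case: fintype.splitP => j e;
  rewrite ffunE; congr (x _); apply: val_inj.
Qed.

Definition slice (F : {set cube k (m + p)}) (a : cube k m) : {set cube k p} :=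
  [set b | cube_cat a b \in F].

Lemma card_slices (F : {set cube k (m + p)}) : #|F| = \sum_a #|slice F a|.
Proof.
rewrite -sum1_card big_mkcond (reindex _ (onW_bij _ cube_cat_bij)) /=.
rewrite -(pair_bigA _ (fun a b => if cube_cat a b \in F then 1 else 0)) /=.
by apply: eq_bigr => a _; rewrite -big_mkcond -sum1dep_card.
Qed.

(** The two terms come from summing [chain_bound]: there are [middle_card k m] chains, and their
    lengths add up to [k ^ m]. *)
Lemma card_le_slices (F : {set cube k (m + p)}) N : 0 < k ->
  (forall a a' : cube k m, cube_le a a' -> a <> a' -> #|slice F a :&: slice F a'| <= N) ->
  (INR #|F| <= INR (middle_card k m) * INR k ^ p + INR k ^ m * sqrt (INR N * INR k ^ p))%R.
Proof.
move=> k0 codeg; have [Cs pCs [sCs chain]] := chain_partition m k0.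
have uCs : uniq (flatten Cs) by rewrite (perm_uniq pCs) enum_uniq.
have chain_bound c : c \in Cs ->
  (INR (\sum_(a <- c) #|slice F a|) <= INR k ^ p + INR (size c) * sqrt (INR N * INR k ^ p))%R.
  move=> cCs.
  have := @sqr_sum_card_le (cube k p) N (map (slice F) c).
  rewrite size_map big_map card_ffun !card_ord pairwise_map => /(_ _)/INR_leq H.
  have {}H : (INR (\sum_(a <- c) #|slice F a|) ^ 2 <=
      INR k ^ p * (INR (\sum_(a <- c) #|slice F a|) + INR (size c) ^ 2 * INR N))%R.
    move: H; rewrite !(INR_expn, INR_muln, INR_addn); apply.
    have uc : uniq c.
      by move: uCs; case/splitPr: cCs => s1 s2;
        rewrite flatten_cat /= !cat_uniq => /and4P[_ _ ? _].
    have := chain _ cCs; move: uc; rewrite uniq_pairwise => uc pc.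
    (* A chain without repetition is strictly increasing, so [codeg] applies to any two of its
       entries. *)
    have : pairwise [rel a a' | (a != a') && cube_le a a'] c.
      elim: (c) uc pc => //= a s IH /andP[as1 s1] /andP[as2 s2].
      rewrite IH // andbT; apply/allP => x xs; apply/andP.
      by split; [exact: (allP as1)|exact: (allP as2)].
    by apply: sub_pairwise => a a' /= /andP[/eqP ne le]; exact: codeg.
  set D := INR _ in H *; set P := (INR k ^ p)%R in H *.
  have P0 : (0 <= P)%R by apply: pow_le; exact: pos_INR.
  have N0 := pos_INR N; have l0 := pos_INR (size c); have D0 : (0 <= D)%R by exact: pos_INR.
  have NP0 : (0 <= INR N * P)%R by nra.
  have s0 := sqrt_pos (INR N * P); have ss := sqrt_sqrt _ NP0.
  (* If [D > P + Q], then [D * (D - P) > Q * Q], against [H]. *)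
  apply: Rnot_lt_le => lt.
  set Q := (INR (size c) * _)%R in lt.
  have Q0 : (0 <= Q)%R by rewrite /Q; nra.
  have QQ : (Q * Q = P * (INR (size c) ^ 2 * INR N))%R.
    rewrite /Q.
    transitivity (INR (size c) ^ 2 * (sqrt (INR N * P) * sqrt (INR N * P)))%R; first ring.
    by rewrite ss; ring.
  nra.
rewrite card_slices -sCs.
have -> : \sum_a #|slice F a| = \sum_(c <- Cs) \sum_(a <- c) #|slice F a|.
  by rewrite -big_enum -(perm_big _ pCs) big_flatten.
have -> : (INR k ^ m = INR (\sum_(c <- Cs) size c))%R.
  have -> : \sum_(c <- Cs) size c = size (flatten Cs) by rewrite size_flatten sumnE big_map.
  by rewrite (perm_size pCs) -cardE card_ffun !card_ord INR_expn.
elim: Cs chain_bound {pCs sCs chain uCs} => [|c Cs IH] chain_bound.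
  by rewrite !big_nil /=; lra.
rewrite !big_cons !INR_addn [size _]/= S_INR.
have h1 := chain_bound c (mem_head _ _).
have h2 := IH (fun c1 h => chain_bound c1 (@mem_behead _ (c :: Cs) c1 h)).
have E (P s x u v : R) : (P + u * s + (x * P + v * s) = (x + 1) * P + (u + v) * s)%R by ring.
by rewrite -E; exact: Rplus_le_compat h1 h2.
Qed.
End Product.

(** * Boolean algebras from comparable points *)

Lemma contains_boolean_algebra1 k n (F : {set cube k n}) x y :
  x \in F -> y \in F -> cube_le x y -> x <> y -> contains_boolean_algebra 1 F.
Proof.
move=> xF yF /forallP xy ne; exists x, (fun _ i => y i - x i); split; [|split; [|split]].
- by move=> _ i; have := ltn_ord (y i); lia.
- move=> _; have [i xyi] : exists i, x i != y i.
    by apply/existsP; apply: contra_notT ne => /existsPn E; apply/ffunP => i; apply/eqP/negPn/E.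
  by exists i; have := xy i; move: xyi; rewrite -val_eqE /=; lia.
- by move=> i j; rewrite !ord1.
- move=> I; exists (if ord0 \in I then y else x); split; first by case: ifP.
  move=> i; rewrite /ba_point big_mkcond big_ord1; case: ifP => _; last by rewrite addn0.
  by rewrite subnKC //; exact: xy.
Qed.

(** The new direction [a' - a] lives on the first [m] coordinates and the old ones on the last [p],
    hence disjointness. Every point [w] of the small algebra lies in both slices, so it can be
    completed by [a] as well as by [a']. *)
Lemma contains_boolean_algebraS k m p d (F : {set cube k (m + p)}) a a' :
  cube_le a a' -> a <> a' ->
  contains_boolean_algebra d (slice F a :&: slice F a') ->
  contains_boolean_algebra d.+1 F.
Proof.
move=> /forallP aa' ne [v0 [v [vk [v_neq0 [v_disj vF]]]]].
pose u (i : 'I_d.+1) (x : 'I_(m + p)) : nat :=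
  match unlift ord0 i, fintype.split x with
  | None, inl j => a' j - a j
  | Some i', inr j => v i' j
  | _, _ => 0
  end.
have u0l j : u ord0 (lshift p j) = a' j - a j by rewrite /u unlift_none (unsplitK (inl j)).
have u0r j : u ord0 (rshift m j) = 0 by rewrite /u unlift_none (unsplitK (inr j)).
have ul i j : u (lift ord0 i) (lshift p j) = 0 by rewrite /u liftK (unsplitK (inl j)).
have ur i j : u (lift ord0 i) (rshift m j) = v i j by rewrite /u liftK (unsplitK (inr j)).
exists (cube_cat a v0), u; split; [|split; [|split]].
- move=> i x; case: (unliftP ord0 i) => [i' ->|->]; case: (split_ordP x) => j ->.
  + by rewrite ul; have := ltn_ord (a j); lia.
  + by rewrite ur.
  + by rewrite u0l; have := ltn_ord (a' j); lia.
  + by rewrite u0r; have := ltn_ord (v0 j); lia.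
- move=> i; case: (unliftP ord0 i) => [i' ->|->].
    by have [j vj] := v_neq0 i'; exists (rshift m j); rewrite ur.
  have [j ne_j] : exists j, a j != a' j.
    by apply/existsP; apply: contra_notT ne => /existsPn E; apply/ffunP => j; apply/eqP/negPn/E.
  exists (lshift p j); rewrite u0l; have := aa' j; move: ne_j; rewrite -val_eqE /=; lia.
- move=> i i' x; case: (unliftP ord0 i) (unliftP ord0 i') => [j ->|->] [j' ->|->];
    case: (split_ordP x) => y -> ne_ii'; rewrite ?ul ?u0r; auto; try by case: ne_ii'.
  by rewrite !ur; apply: v_disj => E; apply: ne_ii'; rewrite E.
- move=> I; have [w []] := vF [set i | lift ord0 i \in I].
  rewrite !inE => /andP[wa wa'] Ew.
  exists (cube_cat (if ord0 \in I then a' else a) w); split; first by case: ifP.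
  move=> x; rewrite /ba_point big_mkcond big_ord_recl.
  case: (split_ordP x) => j ->.
    rewrite !cube_catl u0l big1 => [|i _]; last by rewrite ul if_same.
    by case: ifP => _ /=; rewrite !addn0 ?subnKC //; exact: aa'.
  rewrite !cube_catr u0r if_same Ew /ba_point; congr (_ + _).
  by rewrite big_mkcond; apply: eq_bigr => i _; rewrite inE ur.
Qed.

(** * Density bound by induction on the dimension *)

Section Density.
Local Open Scope R_scope.

Lemma middle_card_leR k n : (2 <= k)%N -> (0 < n)%N ->
  INR (middle_card k n) * (INR k * sqrt (INR n)) <= 3 * INR k ^ n.
Proof.
case: n => // n k2 _; have /INR_leq := middle_card_le k2 n.
rewrite !(INR_muln, INR_expn) (_ : INR 9 = 9); last by rewrite /=; ring.
set M := INR (middle_card _ _); rewrite -[INR k ^ n.+1]/(INR k * INR k ^ n) => H.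
have k0 := pos_INR k; have kn0 : 0 <= INR k ^ n by exact: pow_le.
suff : M * sqrt (INR n.+1) <= 3 * INR k ^ n by nra.
apply: Rsqr_incr_0_var; last lra.
by rewrite /Rsqr; have := sqrt_sqrt _ (pos_INR n.+1); nra.
Qed.

Lemma Rpower_le1 x e : 1 <= x -> 0 <= e <= 1 -> Rpower x e <= x.
Proof.
move=> x1 e01; rewrite -{2}(Rpower_1 x); last lra.
by apply: Rle_Rpower; lra.
Qed.

Lemma pow2_inv_bounds d : 0 < / 2 ^ d <= 1.
Proof.
have p1 : 1 <= 2 ^ d by apply: pow_R1_Rle; lra.
split; first by apply: Rinv_0_lt_compat; lra.
by rewrite -Rinv_1; apply: Rinv_le_contravar; lra.
Qed.

(** Since [d <= 2 ^ d], the root of [2 ^ d] is at most 2. This serves the case of small [n]. *)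
Lemma Rpower_root_le2 d x : 0 < x <= 2 ^ d -> Rpower x (/ 2 ^ d) <= 2.
Proof.
move=> xd; have e01 := pow2_inv_bounds d.
apply: (Rle_trans _ (Rpower (2 ^ d) (/ 2 ^ d))); first by apply: Rle_Rpower_l; lra.
rewrite -{1}(Rpower_pow d 2); last lra.
rewrite Rpower_mult -[X in _ <= X](Rpower_1 2); last lra.
apply: Rle_Rpower; first lra.
have lt : INR d <= 2 ^ d.
  by have := INR_leq (ltnW (ltn_expl d (isT : 1 < 2)%N)); rewrite INR_expn.
have := Rinv_r (2 ^ d) ltac:(apply: pow_nonzero; lra); nra.
Qed.

Lemma sqrt_leq4 m n : (n <= 4 * m)%N -> sqrt (INR n) <= 2 * sqrt (INR m).
Proof.
move=> /INR_leq; rewrite INR_muln (_ : INR 4 = 2 * 2); last by rewrite /=; ring.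
move=> nm; rewrite -[X in X * sqrt _](sqrt_square 2); last lra.
by rewrite -sqrt_mult_alt; [apply: sqrt_le_1_alt|lra].
Qed.

(** The square root from Cauchy-Schwarz halves the exponent, and passing from [t] to [s] costs a
    factor of at most 2. *)
Lemma density_step d s t : 0 < s -> 0 < t -> s <= 2 * t ->
  sqrt (Rpower t (- / 2 ^ d)) <= 2 * Rpower s (- / 2 ^ d.+1).
Proof.
move=> s0 t0 st; have e01 := pow2_inv_bounds d.+1; set e := / 2 ^ d.+1 in e01 *.
have -> : - / 2 ^ d = - e + - e by rewrite /e /=; field; apply: pow_nonzero; lra.
rewrite Rpower_plus sqrt_square; last by apply: Rlt_le; exact: exp_pos.
rewrite !Rpower_Ropp.
have pt : 0 < Rpower t e by exact: exp_pos.
have ps : 0 < Rpower s e by exact: exp_pos.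
have le : Rpower s e <= 2 * Rpower t e.
  apply: (Rle_trans _ (Rpower (2 * t) e)); first by apply: Rle_Rpower_l; lra.
  rewrite -Rpower_mult_distr; try lra.
  by apply: Rmult_le_compat_r; [lra|apply: Rpower_le1; lra].
apply: (Rmult_le_reg_l (Rpower t e * Rpower s e)); first by nra.
by field_simplify; lra.
Qed.

(** The constant 16 survives the induction: the chains contribute 6, the intersections
    [2 * sqrt 16 = 8], and 6 + 8 <= 16. *)
Lemma boolean_free_density d k n (F : {set cube k n}) :
  (2 <= k)%N -> (d < n)%N -> ~ contains_boolean_algebra d.+1 F ->
  INR #|F| <= 16 * INR k ^ n * Rpower (INR k * sqrt (INR n)) (- / 2 ^ d).
Proof.
elim: d k n F => [|d IH] k n F k2 dn freeF.
  have k1 : 0 < INR k by apply: lt_0_INR; lia.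
  have n1 : 0 < sqrt (INR n) by apply: sqrt_lt_R0; apply: lt_0_INR; lia.
  have s0 : 0 < INR k * sqrt (INR n) by nra.
  rewrite Rinv_1 Rpower_Ropp Rpower_1 //.
  have FM : INR #|F| <= INR (middle_card k n).
    apply/INR_leq/antichain_card; first lia.
    move=> x y xF yF xy; apply/eqP/negPn/negP => /eqP ne.
    by apply: freeF; exact: contains_boolean_algebra1 xF yF xy ne.
  have H := middle_card_leR k2 dn.
  apply: (Rmult_le_reg_r (INR k * sqrt (INR n))) => //.
  rewrite Rmult_assoc Rinv_l; last lra.
  have := pow_le _ n (Rlt_le _ _ k1); have := pos_INR #|F|; nra.
set e := / 2 ^ d.+1.
have e01 : 0 < e <= 1 by exact: pow2_inv_bounds.
have k1 : 1 <= INR k by apply: (le_INR 1); lia.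
have n1 : 1 <= INR n by apply: (le_INR 1); lia.
have sn1 : 1 <= sqrt (INR n) by rewrite -sqrt_1; apply: sqrt_le_1_alt.
set s := INR k * sqrt (INR n).
have s1 : 1 <= s by rewrite /s; nra.
(* The split must leave [p > d] for the induction and [n <= 4 * p] for comparing [s] with [t], while
   [key] keeps the number of chains of [k]^m at most 6 k^m / s^e. *)
have [m [p [En m0 dp np] key]] : exists m, exists2 p,
    [/\ n = (m + p)%N, (0 < m)%N, (d < p)%N & (n <= 4 * p)%N] &
    Rpower s e <= 2 * (INR k * sqrt (INR m)).
  have [le|lt] := leqP (2 * d.+1) n.
    exists n./2, (n - n./2)%N; first by split; lia.
    apply: (Rle_trans _ s); first by apply: Rpower_le1; lra.
    have : sqrt (INR n) <= 2 * sqrt (INR n./2) by apply: sqrt_leq4; lia.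
    by rewrite /s; nra.
  (* Here [n < 2 * d.+1 <= 2 ^ d.+1], so the factor [sqrt n] of [s] contributes at most 2 to
     [Rpower s e]. *)
  exists 1%N, n.-1; first by split; lia.
  rewrite sqrt_1 Rmult_1_r /s -Rpower_mult_distr; try lra.
  have ke : Rpower (INR k) e <= INR k by apply: Rpower_le1; lra.
  have ne : Rpower (sqrt (INR n)) e <= 2.
    apply: Rpower_root_le2; split; first lra.
    have := sqrt_sqrt (INR n) ltac:(lra).
    suff : INR n <= 2 ^ d.+1 by nra.
    rewrite -[2]/(INR 2) -INR_expn; apply: INR_leq.
    by have := ltn_expl d (isT : 1 < 2)%N; rewrite expnS; lia.
  have := exp_pos (e * ln (INR k)); rewrite -/(Rpower (INR k) e) => kp.
  have := exp_pos (e * ln (sqrt (INR n))); rewrite -/(Rpower (sqrt (INR n)) e) => np.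
  nra.
subst n.
(* The largest intersection over strictly comparable pairs; the maximum starts from 0, whence the
   first case of the induction over it. *)
pose N := (\max_(q : cube k m * cube k m | cube_le q.1 q.2 && (q.1 != q.2))
             #|slice F q.1 :&: slice F q.2|)%N.
have Np : INR N <= 16 * INR k ^ p * Rpower (INR k * sqrt (INR p)) (- / 2 ^ d).
  apply: (big_ind (fun x => INR x <= _)) => [|x y hx hy|[a a'] /andP[/= le /eqP ne]].
  - have := exp_pos (- / 2 ^ d * ln (INR k * sqrt (INR p))); rewrite -/(Rpower _ _) => r0.
    have := pow_le (INR k) p ltac:(lra); rewrite [INR 0]/=; nra.
  - by rewrite /maxn; case: ifP.
  - apply: IH => // algebra; apply: freeF; exact: contains_boolean_algebraS le ne algebra.
have := card_le_slices (N := N) (F := F) _ _.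
move=> /(_ ltac:(lia)) /(_ _)/Rle_trans; apply.
  by move=> a a' le /eqP ne; rewrite /N (bigmax_sup (a, a')) //= le.
have p1 : 1 <= INR p by apply: (le_INR 1); lia.
have sp1 : 1 <= sqrt (INR p) by rewrite -sqrt_1; apply: sqrt_le_1_alt.
have m1 : 1 <= INR m by apply: (le_INR 1); lia.
have sm1 : 1 <= sqrt (INR m) by rewrite -sqrt_1; apply: sqrt_le_1_alt.
set t := INR k * sqrt (INR p) in Np.
have t1 : 1 <= t by rewrite /t; nra.
have st : s <= 2 * t by rewrite /s /t; have := sqrt_leq4 np; nra.
have kp0 : 0 < INR k ^ p by apply: pow_lt; lra.
have km0 : 0 < INR k ^ m by apply: pow_lt; lra.
have sqrtN : sqrt (INR N * INR k ^ p) <= 4 * INR k ^ p * (2 * Rpower s (- e)).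
  apply: (Rle_trans _ (sqrt ((4 * INR k ^ p) * (4 * INR k ^ p) * Rpower t (- / 2 ^ d)))).
    by apply: sqrt_le_1_alt; nra.
  rewrite sqrt_mult_alt; last nra.
  rewrite sqrt_square; last nra.
  by apply: Rmult_le_compat_l; [lra|apply: density_step; lra].
have M_le : INR (middle_card k m) <= 6 * INR k ^ m * Rpower s (- e).
  have H := middle_card_leR k2 m0; rewrite Rpower_Ropp.
  have pe : 0 < Rpower s e by exact: exp_pos.
  apply: (Rmult_le_reg_r (Rpower s e)) => //.
  rewrite Rmult_assoc Rinv_l; last lra.
  have := pos_INR (middle_card k m); nra.
have pe : 0 < Rpower s (- e) by exact: exp_pos.
rewrite pow_add; set r := Rpower s (- e) in sqrtN M_le pe *.
have H1 := Rmult_le_compat_r _ _ _ (Rlt_le _ _ kp0) M_le.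
have H2 := Rmult_le_compat_l _ _ _ (Rlt_le _ _ km0) sqrtN.
have : 0 < INR k ^ m * INR k ^ p * r by apply: Rmult_lt_0_compat => //; apply: Rmult_lt_0_compat.
move=> H3; lra.
Qed.
End Density.

(** * Set families as subsets of [2]^n *)

Section SetFamilies.
Variable n : nat.

Definition ones (x : cube 2 n) : {set 'I_n} := [set i | x i == 1 :> nat].

Lemma ones_bij : bijective ones.
Proof.
exists (fun A : {set 'I_n} => [ffun i => inord (i \in A)] : cube 2 n) => [x|A].
  apply/ffunP => i; rewrite ffunE inE; apply: val_inj; rewrite /= inordK; last by case: eqP.
  by case: (x i) => [[|[|?]] ?].
by apply/setP => i; rewrite inE ffunE inordK; case: (i \in A).
Qed.

Lemma contains_set_boolean_algebra_ones d (F : {set {set 'I_n}}) :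
  contains_boolean_algebra d (ones @^-1: F) -> contains_set_boolean_algebra d F.
Proof.
move=> [v0 [v [vk [v_neq0 [v_disj vF]]]]].
exists (ones v0), (fun i => [set x | v i x == 1]); split; [|split; [|split]].
- move=> i; have [x vx] := v_neq0 i; apply/set0Pn; exists x; rewrite inE.
  by have := vk i x; move: vx; lia.
- move=> i; rewrite -setI_eq0; apply/eqP/setP => x; rewrite !inE.
  (* Where [v0] and [v i] are both 1, the algebra point for [[set i]] would have the value 2,
     outside the cube. *)
  have [w [_ /(_ x)]] := vF [set i]; rewrite /ba_point big_set1.
  by have := ltn_ord (w x); lia.
- move=> i j ne; rewrite -setI_eq0; apply/eqP/setP => x; rewrite !inE.
  by have := v_disj i j x ne; lia.
- move=> I; have [w []] := vF I; rewrite inE => wF Ew.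
  suff -> : set_ba_point (ones v0) (fun i => [set x | v i x == 1]) I = ones w by [].
  apply/setP => x; rewrite !inE Ew /ba_point.
  have [/bigcupP[i iI]|/bigcupP nex] := @boolP (x \in \bigcup_(i in I) [set y | v i y == 1]).
    rewrite inE => /eqP vix; rewrite orbT; apply/esym.
    have := ltn_ord (w x); rewrite Ew /ba_point (bigD1 i) //= vix; lia.
  rewrite orbF big1 ?addn0 // => i iI; have := vk i x.
  suff : v i x <> 1 by lia.
  by move=> vix; apply: nex; exists i => //; rewrite inE vix.
Qed.

Lemma card_ones_preim (F : {set {set 'I_n}}) : #|ones @^-1: F| = #|F|.
Proof. by apply: on_card_preimset; exact: onW_bij ones_bij. Qed.
End SetFamilies.

(** * The bound in the form of the theorem *)

Lemma Rpower_density k n d : 0 < k -> 0 < n ->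
  (INR k ^ n * Rpower (INR k * sqrt (INR n)) (- / 2 ^ d) =
   Rpower (INR k) (INR n - / 2 ^ d) * Rpower (INR n) (- / 2 ^ d.+1))%R.
Proof.
move=> /ltP/lt_0_INR k0 /ltP/lt_0_INR n0.
rewrite -Rpower_mult_distr //; last exact: sqrt_lt_R0.
(* Writing [sqrt n] as a power with exponent 1/2 turns [/ 2 ^ d] into [/ 2 ^ d.+1]. *)
rewrite -(Rpower_sqrt _ n0) Rpower_mult -(Rpower_pow n) // -Rmult_assoc -Rpower_plus.
by congr (_ * Rpower _ _)%R; rewrite /=; field; apply: pow_nonzero; lra.
Qed.

Theorem theorem2p5 :
  exists K : R, (0 < K)%R /\
    (forall (k n d : nat), 2 <= k -> 0 < d -> d <= n ->
       forall F : {set cube k n}, ~ contains_boolean_algebra d F ->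
         (INR #|F| <= K * Rpower (INR k) (INR n - / (2 ^ (d - 1)))
                        * Rpower (INR n) (- / (2 ^ d)))%R) /\
    (forall (n d : nat), 0 < d -> d <= n ->
       b_le n d (K * 2 ^ n * Rpower (INR n) (- / (2 ^ d)))%R).
Proof.
have bound k n d : 2 <= k -> 0 < d -> d <= n ->
    forall F : {set cube k n}, ~ contains_boolean_algebra d F ->
    (INR #|F| <= 16 * Rpower (INR k) (INR n - / (2 ^ (d - 1)))
                    * Rpower (INR n) (- / (2 ^ d)))%R.
  case: d => // d k2 _ dn F freeF; rewrite subn1 Rmult_assoc -Rpower_density; try lia.
  by rewrite -Rmult_assoc; exact: boolean_free_density.
exists 16%R; split; [lra|split=> // n d d0 dn F freeF].
have free2 : ~ contains_boolean_algebra d (@ones n @^-1: F).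
  by move/contains_set_boolean_algebra_ones.
have := bound 2 n d isT d0 dn _ free2; rewrite card_ones_preim => /Rle_trans; apply.
apply: Rmult_le_compat_r; first exact/Rlt_le/exp_pos.
apply: Rmult_le_compat_l; first lra.
(* For [k = 2] the factor [Rpower 2 (- / 2 ^ (d - 1))] is at most 1 and is dropped. *)
apply: (Rle_trans _ (Rpower 2 (INR n))); last by rewrite Rpower_pow; lra.
apply: Rle_Rpower; first by rewrite /=; lra.
have := pow2_inv_bounds (d - 1); lra.
Qed.
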